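(* Let $\lambda$ be an infinite cardinal, let $G_1$ be a locally finite group of cardinality $\le\lambda$, and let $G_2\supseteq G_1$ be a locally finite group of cardinality $\le\mu$, where $\mu=\mu^\lambda$ (e.g. $G_1,G_2$ are of cardinality $\lambda$ and $\mu=2^\lambda$). Then there is a pair $(G_3,X)$ such that: (a) $G_2\subseteq G_3$ and $G_3$ is a locally finite group of cardinality $\mu$; (b) $X\subseteq G_3$ has cardinality $\le 2^\lambda$; (c) for every $c\in G_3$ exactly one of the following occurs: $(\alpha)$ $c\in X$ and $\{b\in G_3:\mathrm{tp}_{\mathrm{at}}(b,G_1,G_3)=\mathrm{tp}_{\mathrm{at}}(c,G_1,G_3)\}$ is a singleton (and this holds also in $G_4$ in place of $G_3$ whenever $G_3\subseteq G_4$ and $G_4$ is a locally finite group); $(\beta)$ there are $\|G_3\|$ elements of $G_3$ realizing $\mathrm{tp}_{\mathrm{bs}}(c,G_1,G_3)$; (d) if $\alpha<\lambda^+$, $\bar a\in{}^\alpha(G_3)$, $p(\bar x_{[\alpha]})=\mathrm{tp}_{\mathrm{at}}(\bar a,G_1,G_3)$ and $p'(\bar x_{[\alpha]})=\mathrm{tp}_{\mathrm{bs}}(\bar a,G_1,G_3)$, then there is a non-empty family $\mathcal{P}$ of subsets of $\alpha$, closed under intersections of two members and with $\alpha\in\mathcal{P}$, such that: $(\alpha)$ if $\bar a',\bar a''\in{}^\alpha(G_3)$ realize $p(\bar x_{[\alpha]})$, then $\{\beta<\alpha:a'_\beta=a''_\beta\}\in\mathcal{P}$; $(\beta)$ if $u\in\mathcal{P}$,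 then there is a sequence $\langle\bar a_\varepsilon:\varepsilon<\|G_3\|\rangle$ of members of ${}^\alpha(G_3)$, $\bar a_\varepsilon=\langle a_{\varepsilon,\beta}:\beta<\alpha\rangle$, which is a $\Delta$-system with heart $u$, i.e. $a_{\varepsilon_1,\beta_1}=a_{\varepsilon_2,\beta_2}$ if and only if $(\varepsilon_1,\beta_1)=(\varepsilon_2,\beta_2)$ or $\beta_1=\beta_2\in u$, and each $\bar a_\varepsilon$ realizes $p(\bar x_{[\alpha]})$ and even $p'(\bar x_{[\alpha]})$.
   Context: A group is locally finite if each finitely generated subgroup is finite. $G\subseteq H$ means $G$ is a subgroup of $H$; $\|G\|$ is the cardinality of $G$. ${}^\alpha G$ is the set of sequences of length $\alpha$ of elements of $G$, and $\bar x_{[\alpha]}=\langle x_\beta:\beta<\alpha\rangle$. For $G\subseteq H$ and a sequence $\bar a$ from $H$ (possibly infinite, each formula using only finitely many variables): $\mathrm{tp}_{\mathrm{at}}(\bar a,G,H)$ is the set of atomic formulas (group-word equations) in the variables $\bar x$ with parameters from $G$ satisfied by $\bar a$ in $H$; $\mathrm{tp}_{\mathrm{bs}}(\bar a,G,H)$ is the set of basic formulas (atomic formulas and negations of atomic formulas) in $\bar x$ with parameters from $G$ satisfied by $\bar a$ in $H$. A sequence realizes a type if it satisfies all formulas in it.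
   Formalization: In (d)(β) the clause is false if ā has repetitions (e.g. ā=⟨e,e⟩), so positions β₁,β₂ are compared up to a_{β₁}=a_{β₂} instead of β₁=β₂; for ā without repetitions this is the stated Δ-system condition. *)

(* Defs.v *)
From mathcomp Require Import all_boot.
From mathcomp Require Import boolp classical_sets functions cardinality.
From mathcomp Require wochoice.

Set Implicit Arguments.
Unset Strict Implicit.
Unset Printing Implicit Defensive.

Local Open Scope classical_set_scope.

(* Cardinals are represented by types, up to equipotence (#= and #<=).
   "G is a subgroup of H" is represented by an injective morphism
   i : {multiplicative G -> H}; between groups, such a map also preserves
   1 and inverses. *)

Section LocallyFinite.
Variable G : groupType.

Definition is_subgroup (H : set G) : Prop :=
  [/\ H 1%g, forall x y, H x -> H y -> H (x * y)%g
    & forall x, H x -> H (x^-1)%g].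

Definition generated (S : set G) : set G := smallest is_subgroup S.

Definition finitely_generated (H : set G) : Prop :=
  exists2 S : set G, finite_set S & H = generated S.

Definition locally_finite : Prop :=
  forall H : set G, is_subgroup H -> finitely_generated H -> finite_set H.

End LocallyFinite.

Section Formulas.
Variables (V K : Type).

(* Group words in variables from V with parameters from K. *)
Inductive gword : Type :=
| WVar of V
| WPar of K
| WOne
| WMul of gword & gword
| WInv of gword.

Inductive atomic : Type := Eqn of gword & gword.

Inductive basic : Type :=
| Pos of atomic
| Neg of atomic.

End Formulas.

Section Types.
Variables (V : Type) (G H : groupType) (i : G -> H).
Implicit Type a : V -> H.

Fixpoint weval a (w : gword V G) : H :=
  match w with
  | WVar v => a v
  | WPar g => i g
  | WOne => 1%g
  | WMul w1 w2 => (weval a w1 * weval a w2)%g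
  | WInv w1 => ((weval a w1)^-1)%g
  end.

Definition sat_at a (f : atomic V G) : Prop :=
  let: Eqn w1 w2 := f in weval a w1 = weval a w2.

Definition sat_bs a (f : basic V G) : Prop :=
  match f with
  | Pos g => sat_at a g
  | Neg g => ~ sat_at a g
  end.

(* The types of the sequence a over G in H, where G sits in H through i. *)
Definition tp_at a : set (atomic V G) := [set f | sat_at a f].
Definition tp_bs a : set (basic V G) := [set f | sat_bs a f].

Definition realizes_at (p : set (atomic V G)) a : Prop :=
  forall f, p f -> sat_at a f.
Definition realizes_bs (p : set (basic V G)) a : Prop :=
  forall f, p f -> sat_bs a f.

End Types.

(* An element seen as a sequence of length 1. *)
Definition seq1 (T : Type) (c : T) : unit -> T := fun=> c.

Definition is_singleton (T : Type) (S : set T) : Prop :=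
  exists x : T, S = [set x].

Definition exactly_one (P Q : Prop) : Prop := (P /\ ~ Q) \/ (~ P /\ Q).

Section DeltaSystem.
Variables (E A T : Type).
Implicit Types (u : set A) (s : E -> A -> T) (a : A -> T).

Definition delta_system u s : Prop :=
  forall (e1 e2 : E) (b1 b2 : A),
    s e1 b1 = s e2 b2 <-> (e1, b1) = (e2, b2) \/ (b1 = b2 /\ u b1).

(* If a has repetitions, a b1 = a b2 with b1 <> b2, then no family of
   sequences realizing the atomic type of a satisfies delta_system, since
   each of them has the same repetitions.  Hence positions b1, b2 are
   compared here up to a b1 = a b2; for a without repetitions this is
   delta_system, by delta_system_alongE. *)
Definition delta_system_along a u s : Prop :=
  forall (e1 e2 : E) (b1 b2 : A),
    s e1 b1 = s e2 b2 <->
    (e1 = e2 /\ a b1 = a b2) \/ (a b1 = a b2 /\ u b1).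

Lemma delta_system_alongE a u s :
  injective a -> delta_system_along a u s <-> delta_system u s.
Proof.
move=> a_inj; split=> ds e1 e2 b1 b2; rewrite ds; split.
- by case=> [[-> /a_inj ->]|[/a_inj -> ?]]; [left|right].
- by case=> [[-> ->]|[-> ?]]; [left|right].
- by case=> [[-> ->]|[-> ?]]; [left|right].
- by case=> [[-> /a_inj ->]|[/a_inj -> ?]]; [left|right].
Qed.

End DeltaSystem.

(* Main.v *)
From HB Require Import structures.
From mathcomp Require Import all_boot fingroup perm.
From mathcomp Require Import boolp classical_sets functions cardinality.
From mathcomp Require wochoice.
Require Import Defs.

Set Implicit Arguments.
Unset Strict Implicit.
Unset Printing Implicit Defensive.

Local Open Scope classical_set_scope.
Local Open Scope card_scope.

(* Call c in G2 movable if the atomic type of c over G1 is realized by some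
   b <> c in some locally finite extension of G2.  Choose such an extension H_c
   and such a b_c for every movable c.  In the product of the H_c, the subgroup
   K generated by the diagonal copy of G2 and the tuples obtained from the
   diagonal of c by putting b_c at coordinate c is locally finite, because its
   elements differ from diagonal ones at finitely many coordinates.  Hence one
   extension K of G2 moves all the movable elements at once.

   G3 consists of the functions from the cube {0,1}^W to K that depend on
   finitely many coordinates and take a value in G2 at the origin, where
   W = (M + 1) x 2^L.  An equation holds in G3 iff it holds at every point of
   the cube.
   - The supports of at most lambda elements of G3 miss (M + 1) x {p} for some
     p in 2^L.  If a, a', a'' do not depend on the coordinates t0 and t_e, the
     sequences x |-> if x(t0) then a(x) else if x(t_e) then a'(x) else a''(x)
     realize the basic type of a when a', a'' realize its atomic type; for
     varying e they form a Delta-system with heart {a' = a''}.  Similarly,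
     choosing between two pairs of realizations according to one coordinate
     intersects the sets where they agree.
   - If c in G3 is the only realization of its atomic type, then c is constant,
     since the constant c(origin) satisfies all equations of c.  Moreover
     c(origin) is not movable, since otherwise a function with both values
     c(origin) and b would be a second realization.  Hence no locally finite
     extension of G3 contains a second realization either. *)

(** * Cardinal arithmetic *)

Lemma inj_on_card_le (T U : Type) (A : set T) (B : set U) (f : T -> U) :
  (forall x, A x -> B (f x)) ->
  (forall x y, A x -> A y -> f x = f y -> x = y) -> A #<= B.
Proof.
move=> fAB f_inj.
have /injfunPex[g] : exists2 f : T -> U, set_fun A B f & set_inj A f.
  by exists f => // x y /set_mem Ax /set_mem Ay; apply: f_inj.
exact: inj_card_le.
Qed.

Lemma card_leTTP (T U : Type) :
  [set: T] #<= [set: U] <-> exists f : T -> U, injective f.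
Proof.
split=> [/card_leP[f]|[f f_inj]].
  exists (fun x => val (f (SigSub (mem_set (I : [set: T] x))))) => x y /val_inj fxy.
  by have [] := @inj _ _ _ f _ _ (mem_set I) (mem_set I) fxy.
by apply: inj_on_card_le => // x y _ _; apply: f_inj.
Qed.

(** Zorn's lemma gives a maximal partial injection. It cannot miss both some a in A and some b in B,
    since adding (a, b) would extend it. *)
Lemma card_le_total (T U : Type) (A : set T) (B : set U) :
  (exists2 f : T -> U, (forall x, A x -> B (f x)) &
     forall x y, A x -> A y -> f x = f y -> x = y) \/
  (exists2 f : U -> T, (forall x, B x -> A (f x)) &
     forall x y, B x -> B y -> f x = f y -> x = y).
Proof.
have [->|/set0P[a0 Aa0]] := eqVneq A set0.
  have [[b0]|nU] := pselect (inhabited U); first by left; exists (fun=> b0).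
  by right; exists (fun b => False_rect T (nU (inhabits b))) => b; case: nU.
have [->|/set0P[b0 Bb0]] := eqVneq B set0; first by right; exists (fun=> a0).
pose P (R : set (T * U)) := R `<=` A `*` B /\
  forall p q, R p -> R q -> p.1 = q.1 <-> p.2 = q.2.
have [F FP Ftot|R [[RAB Rinj] Rmax]] := @Zorn_bigcup _ P.
  split=> [p [R /FP[+ _] Rp]|p q [R FR Rp] [S FS Sq]]; first exact.
  have [_ Rinj] := FP _ FR; have [_ Sinj] := FP _ FS.
  by have [/(_ _ Rp)|/(_ _ Sq)] := Ftot _ _ FR FS; auto.
have [tot|/existsNP[a /not_implyP[Aa na]]] :=
  pselect (forall a, A a -> exists b, R (a, b)).
  left.
  have /choice[f fP] : forall a, exists b, A a -> R (a, b).
    move=> a; have [Aa|] := pselect (A a); last by exists b0.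
    by have [b] := tot _ Aa; exists b.
  exists f => [x /fP /RAB []//|x y /fP Rx /fP Ry fxy].
  exact: (Rinj _ _ Rx Ry).2.
right.
have /choice[f fP] : forall b, exists a, B b -> R (a, b).
  move=> b; have [Bb|] := pselect (B b); last by exists a0.
  apply: contrapT => nb; apply: (Rmax (R `|` [set (a, b)])).
    split; first by move=> p; left.
    move=> /(_ (a, b)) Rab; apply: na; exists b; apply: Rab.
    by right.
  have nRb p : R p -> p.2 <> b.
    by move=> Rp pb; apply: nb; exists p.1 => _; rewrite -pb -surjective_pairing.
  have nRa p : R p -> p.1 <> a.
    by move=> Rp pa; apply: na; exists p.2; rewrite -pa -surjective_pairing.
  split=> [p [/RAB//|->//]|p q [Rp|->] [Rq|->]//=]; first exact: Rinj.
    by split=> [/nRa|/nRb]/(_ Rp).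
  by split=> /esym => [/nRa|/nRb]/(_ Rq).
exists f => [x /fP /RAB []//|x y /fP Rx /fP Ry fxy].
exact: (Rinj _ _ Rx Ry).1.
Qed.

(** * Pairing on an infinite set *)

Section PairInjection.
Variable T : Type.

Definition graph_dom (R : set (T * T * T)) : set T := [set x | exists z, R (x, x, z)].

(* R is the graph of an injection from D * D to D, where D = graph_dom R. *)
Definition pairing_graph (R : set (T * T * T)) : Prop :=
  [/\ forall p q, R p -> R q -> p.1 = q.1 <-> p.2 = q.2,
      forall p, R p -> [/\ graph_dom R p.1.1, graph_dom R p.1.2 & graph_dom R p.2]
    & forall x y, graph_dom R x -> graph_dom R y -> exists z, R (x, y, z)].

Lemma pairing_graph_bigcup (F : set (set (T * T * T))) :
  F `<=` pairing_graph -> total_on F subset ->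
  pairing_graph (\bigcup_(R in F) R).
Proof.
move=> FP Ftot.
have join R S : F R -> F S -> exists Q, [/\ F Q, R `<=` Q & S `<=` Q].
  move=> FR FS; have [RS|SR] := Ftot _ _ FR FS; [exists S|exists R]; split=> //.
have domS R x : F R -> graph_dom R x -> graph_dom (\bigcup_(R in F) R) x.
  by move=> FR [z Rz]; exists z, R.
split.
- move=> p q [R FR Rp] [S FS Sq]; have [Q [FQ RQ SQ]] := join _ _ FR FS.
  by have [Qinj _ _] := FP _ FQ; apply: Qinj; [exact: RQ|exact: SQ].
- move=> p [R FR Rp]; have [_ /(_ _ Rp)[? ? ?] _] := FP _ FR.
  by split; exact: domS FR _.
- move=> x y [z [R FR Rz]] [t [S FS St]].
  have [Q [FQ RQ SQ]] := join _ _ FR FS; have [_ _ Qdom] := FP _ FQ.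
  have [|| w Qw] := Qdom x y; [by exists z; exact: RQ|by exists t; exact: SQ|].
  by exists w, Q.
Qed.

(** The starting point for Zorn's lemma: the pairing of the natural numbers is transported to a
    countable subset of [T]. *)
Lemma pairing_graph_image (e : nat -> T) : injective e ->
  pairing_graph [set p | exists i j, p = (e i, e j, e (pickle (i, j)))].
Proof.
move=> e_inj; set R := [set p | _].
have De i : graph_dom R (e i) by exists (e (pickle (i, i))), i, i.
split=> [_ _ [i [j ->]] [k [l ->]]|_ [i [j ->]]|x y [_ [i [_ [-> _ _]]]]] //=.
   split=> [[/e_inj ik /e_inj jl]|/e_inj /(pcan_inj pickleK) [ik jl]].
    by rewrite ik jl.
  by rewrite ik jl.
by move=> [_ [j [_ [-> _ _]]]]; exists (e (pickle (i, j))), i, j.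
Qed.

(* Three disjoint copies of D * D are needed to extend the pairing from D to
   D + g(D); the tags e 0, e 1, e 2 select the copy, which is sent into g(D). *)
Lemma pairing_graph_extend (R : set (T * T * T)) (e : nat -> T) (g : T -> T) :
  pairing_graph R -> injective e -> (forall i, graph_dom R (e i)) ->
  (forall x, graph_dom R x -> ~ graph_dom R (g x)) ->
  (forall x y, graph_dom R x -> graph_dom R y -> g x = g y -> x = y) ->
  exists S, [/\ pairing_graph S, R `<=` S & exists p, S p /\ ~ R p].
Proof.
move=> [Rinj Rcl Rdom] e_inj De gD g_inj; set D := graph_dom R in De gD g_inj.
have /choice[f fP] : forall p : T * T, exists z, D p.1 -> D p.2 -> R (p, z).
  move=> [x y]; have [[Dx Dy]|nD] := pselect (D x /\ D y).
    by have [z] := Rdom x y Dx Dy; exists z.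
  by exists x => Dx Dy; case: nD.
have fD x y : D x -> D y -> D (f (x, y)).
  by move=> Dx Dy; have /Rcl[] := fP (x, y) Dx Dy.
have f_inj x y x' y' : D x -> D y -> D x' -> D y' ->
    f (x, y) = f (x', y') -> x = x' /\ y = y'.
  move=> Dx Dy Dx' Dy' ff.
  by have [] := (Rinj _ _ (fP (x, y) Dx Dy) (fP (x', y') Dx' Dy')).2 ff.
pose E := D `|` g @` D.
(* [r x] is x itself or its preimage under g; together with the truth value of [D x] it determines
   x. *)
have /choice[r rP] : forall x, exists y, E x ->
    D y /\ (D x /\ y = x \/ ~ D x /\ g y = x).
  move=> x; have [Dx|nDx] := pselect (D x); first by exists x; auto.
  have [[y Dy gy]|ng] := pselect ((g @` D) x); last by exists x => -[].
  by exists y => _; split=> //; right; split=> //; rewrite -gy; exact: gD.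
pose k x y := e (`[< D x >] + (`[< D y >]).*2)%N.
pose h x y := g (f (k x y, f (r x, r y))).
have hE x y : E x -> E y -> (g @` D) (h x y).
  move=> /rP[Drx _] /rP[Dry _]; exists (f (k x y, f (r x, r y))) => //.
  by apply: (fD); [exact: De|exact: fD].
have r_inj x x' : E x -> E x' -> `[< D x >] = `[< D x' >] -> r x = r x' -> x = x'.
  move=> /rP[_ rx] /rP[_ rx'] DD rr.
  have {}DD : D x <-> D x' by split=> /asboolP; [rewrite DD|rewrite -DD] => /asboolP.
  case: rx => -[Dx rx]; case: rx' => -[Dx' rx']; try tauto.
  - by rewrite -rx rr.
  - by rewrite -rx rr.
have h_inj x y x' y' : E x -> E y -> E x' -> E y' ->
    h x y = h x' y' -> x = x' /\ y = y'.
  move=> Ex Ey Ex' Ey'.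
  have [[Drx _] [Dry _]] := (rP _ Ex, rP _ Ey).
  have [[Drx' _] [Dry' _]] := (rP _ Ex', rP _ Ey').
  move=> hh; have Df := fD _ _ Drx Dry; have Df' := fD _ _ Drx' Dry'.
  have [/e_inj kk ff] :=
    f_inj _ _ _ _ (De _) Df (De _) Df' (g_inj _ _ (fD _ _ (De _) Df) (fD _ _ (De _) Df') hh).
  have [rx ry] := f_inj _ _ _ _ Drx Dry Drx' Dry' ff.
  suff [Dx Dy] : `[< D x >] = `[< D x' >] /\ `[< D y >] = `[< D y' >].
    by split; apply: r_inj.
  by move: kk; do 4! case: asboolP => _.
pose S := R `|` [set p | [/\ E p.1.1, E p.1.2, ~ (D p.1.1 /\ D p.1.2) & p.2 = h p.1.1 p.1.2]].
have DS : graph_dom S = E.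
  apply/seteqP; split=> [x [z [Rz|[]//]]|x Ex]; first by left; exists z.
  have [Dx|nDx] := pselect (D x); last by exists (h x x); right; split=> // -[].
  by have [z Rz] := Rdom x x Dx Dx; exists z; left.
have hR p x y : R p -> E x -> E y -> p.2 <> h x y.
  move=> /Rcl[_ _ Dp] Ex Ey pE; have [z Dz hz] := hE _ _ Ex Ey.
  by apply: (gD _ Dz); rewrite hz -pE.
exists S; split; last 2 first.
- by move=> p; left.
- have Eg : E (g (e 0)) by right; exists (e 0).
  exists (g (e 0), g (e 0), h (g (e 0)) (g (e 0))); split.
    by right; split=> // -[+ _]; apply: gD.
  by move=> /Rcl[/= + _ _]; apply: gD.
split.
- have RS p q : R p -> E q.1.1 -> E q.1.2 -> ~ (D q.1.1 /\ D q.1.2) ->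
      q.2 = h q.1.1 q.1.2 -> p.1 = q.1 <-> p.2 = q.2.
    move=> Rp Eq1 Eq2 nD qE; split=> pq; last by case: (hR p _ _ Rp Eq1 Eq2); rewrite pq.
    by case: nD; rewrite -pq; have [] := Rcl _ Rp.
  move=> p q [Rp|[Ep1 Ep2 pD pE]] [Rq|[Eq1 Eq2 qD qE]]; first exact: Rinj.
  + exact: RS.
  + by split=> pq; apply/esym/(RS q p).
  + rewrite pE qE; split=> [->//|/h_inj[]// p1 p2].
    by rewrite [p.1]surjective_pairing p1 p2 -surjective_pairing.
- move=> p [Rp|[Ep1 Ep2 _ pE]]; rewrite DS; last first.
    by split=> //; rewrite pE; right; exact: hE.
  by have [? ? ?] := Rcl _ Rp; split; left.
- rewrite DS => x y Ex Ey; have [[Dx Dy]|nD] := pselect (D x /\ D y).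
    by have [z Rz] := Rdom x y Dx Dy; exists z; left.
  by exists (h x y); right.
Qed.

(** Let D be the domain of a maximal pairing graph. If D injects into its complement, the graph
    extends. Otherwise the complement injects into D, so [T] embeds in D as two tagged pieces and
    inherits the pairing of D. *)
Lemma infinite_pair_inj : infinite_set [set: T] ->
  exists f : T * T -> T, injective f.
Proof.
move=> /infiniteP/card_leTTP[e e_inj].
set R0 := [set p | exists i j, p = (e i, e j, e (pickle (i, j)))].
have R0P : pairing_graph R0 by exact: pairing_graph_image.
(* The condition on [R0] is restricted to nonempty graphs so that the union of the empty chain
   satisfies [P]. *)
pose P R := pairing_graph R /\ (R !=set0 -> R0 `<=` R).
have [F FP Ftot|R [[RP R0R] Rmax]] := @Zorn_bigcup _ P.
  split; first by apply: pairing_graph_bigcup => // R /FP[].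
  move=> [p [R FR Rp]] q R0q; have [_ R0R] := FP _ FR.
  by exists R => //; apply: R0R => //; exists p.
have R0sub : R0 `<=` R.
  apply: R0R; apply: contrapT => R_eq0; apply: (Rmax R0); last by split=> // _ p.
  split=> [p Rp|R0R]; first by case: R_eq0; exists p.
  by apply: R_eq0; exists (e 0, e 0, e (pickle (0, 0))); apply: R0R; exists 0, 0.
have De i : graph_dom R (e i).
  by exists (e (pickle (i, i))); apply: R0sub; exists i, i.
have [[g gD g_inj]|[g gD g_inj]] :=
    card_le_total (graph_dom R) (~` graph_dom R).
  have [S [SP RS [p [Sp nRp]]]] := pairing_graph_extend RP e_inj De gD g_inj.
  exfalso; apply: (Rmax S); first by split=> // /(_ p Sp).
  by split=> // _ q /R0sub; exact: RS.
have [Rinj Rcl Rdom] := RP; set D := graph_dom R in De gD g_inj Rcl Rdom.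
have /choice[f fP] : forall p : T * T, exists z, D p.1 -> D p.2 -> R (p, z).
  move=> [x y]; have [[Dx Dy]|nD] := pselect (D x /\ D y).
    by have [z] := Rdom x y Dx Dy; exists z.
  by exists x => Dx Dy; case: nD.
have fD p : D p.1 -> D p.2 -> D (f p).
  by move=> D1 D2; have /Rcl[] := fP p D1 D2.
have f_inj p q : D p.1 -> D p.2 -> D q.1 -> D q.2 -> f p = f q -> p = q.
  by move=> ? ? ? ? ff; apply: (Rinj _ _ (fP p _ _) (fP q _ _)).2.
pose d x := if `[< D x >] then f (e 0, x) else f (e 1, g x).
have dD x : D (d x).
  by rewrite /d; case: asboolP => Dx; apply: fD => /=; [exact: De| |exact: De|exact: gD].
have d_inj : injective d.
  move=> x y; rewrite /d.
  have De0 := De 0; have De1 := De 1.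
  case: asboolP => Dx; case: asboolP => Dy /f_inj fxy.
  - by have [] := fxy De0 Dx De0 Dy.
  - by have [/e_inj] := fxy De0 Dx De1 (gD _ Dy).
  - by have [/e_inj] := fxy De1 (gD _ Dx) De0 Dy.
  - by have [gxy] := fxy De1 (gD _ Dx) De1 (gD _ Dy); apply: g_inj.
exists (fun p => f (d p.1, d p.2)) => -[x y] [x' y'] ff.
by have [/d_inj -> /d_inj ->] := f_inj (_, _) (_, _) (dD _) (dD _) (dD _) (dD _) ff.
Qed.

End PairInjection.

Lemma infinite_nat_inj (T : Type) : infinite_set [set: T] ->
  exists e : nat -> T, injective e.
Proof. by move=> /infiniteP/card_leTTP. Qed.

Lemma card_seq_inj (T U : Type) : infinite_set [set: U] ->
  (exists f : T -> U, injective f) -> exists f : seq T -> U, injective f.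
Proof.
move=> Uoo [j j_inj]; have [f f_inj] := infinite_pair_inj Uoo.
have [e e_inj] := infinite_nat_inj Uoo.
pose code := fix code s :=
  if s is x :: s' then f (e 1, f (j x, code s')) else f (e 0, e 0).
exists code; elim=> [|x s IHs] [|y t] //= /f_inj[].
- by move=> /e_inj.
- by move=> /e_inj.
- by move=> /f_inj[/j_inj -> /IHs ->].
Qed.

Lemma card_prod_inj (S T U : Type) : infinite_set [set: U] ->
  (exists f : S -> U, injective f) -> (exists f : T -> U, injective f) ->
  exists f : S * T -> U, injective f.
Proof.
move=> Uoo [j j_inj] [k k_inj]; have [f f_inj] := infinite_pair_inj Uoo.
by exists (fun p => f (j p.1, k p.2)) => -[x y] [x' y'] /f_inj[/j_inj -> /k_inj ->].
Qed.

(** Cantor's diagonal argument, with D the set of the values f A that lie outside A. *)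
Lemma no_inj_set (T : Type) (f : set T -> T) : ~ injective f.
Proof.
move=> f_inj; pose D := [set x | exists2 A, f A = x & ~ A x].
have [DfD|nDfD] := pselect (D (f D)).
  by have [A /f_inj ->] := DfD.
by apply: (nDfD); exists D.
Qed.

(** * Groups, types and local finiteness *)

Section Morphisms.
Variables (G H : groupType) (f : G -> H).
Hypothesis fM : {morph f : x y / (x * y)%g}.

Lemma morph_mul1 : f 1%g = 1%g.
Proof. by apply: (@mulgI _ (f 1%g)); rewrite -fM !mulg1. Qed.

Lemma morph_mulV : {morph f : x / (x^-1)%g}.
Proof. by move=> x; apply: (@mulgI _ (f x)); rewrite -fM !mulgV morph_mul1. Qed.

Lemma morph_weval (V : Type) (G0 : groupType) (i : G0 -> G) (a : V -> G) w :
  f (weval i a w) = weval (f \o i) (f \o a) w.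
Proof.
elim: w => //= [|w1 IH1 w2 IH2|w IH]; first exact: morph_mul1.
- by rewrite fM IH1 IH2.
- by rewrite morph_mulV IH.
Qed.

Lemma morph_sat_at (V : Type) (G0 : groupType) (i : G0 -> G) (a : V -> G) p :
  sat_at i a p -> sat_at (f \o i) (f \o a) p.
Proof. by case: p => w1 w2 /= E; rewrite -!morph_weval E. Qed.

Lemma inj_sat_at (V : Type) (G0 : groupType) (i : G0 -> G) (a : V -> G) p :
  injective f -> sat_at (f \o i) (f \o a) p -> sat_at i a p.
Proof. by case: p => w1 w2 f_inj /=; rewrite -!morph_weval => /f_inj. Qed.

Lemma preimage_subgroup (B : set H) : is_subgroup B -> is_subgroup (f @^-1` B).
Proof.
move=> [B1 BM BV]; split=> /=; first by rewrite /preimage /= morph_mul1.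
- by move=> x y Bx By; rewrite /preimage /= fM; exact: BM.
- by move=> x Bx; rewrite /preimage /= morph_mulV; exact: BV.
Qed.

End Morphisms.

(** This bounds the number of atomic types over G1 by 2^lambda. Words are coded by nested pairs, and
    the tags e 0, ..., e 4 tell the constructors apart. *)
Lemma atomic_card_inj (L K : Type) : infinite_set [set: L] ->
  (exists f : K -> L, injective f) -> exists f : atomic unit K -> L, injective f.
Proof.
move=> Loo [j j_inj]; have [f f_inj] := infinite_pair_inj Loo.
have [e e_inj] := infinite_nat_inj Loo.
pose code := fix code (w : gword unit K) := match w with
  | WVar _ => f (e 0, e 0)
  | WPar x => f (e 1, j x)
  | WOne => f (e 2, e 0)
  | WMul w1 w2 => f (e 3, f (code w1, code w2))
  | WInv w1 => f (e 4, code w1)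
  end.
have code_inj : injective code.
  elim=> [[]|x||w1 IH1 w2 IH2|w IH] [[]|y||v1 v2|v] //= /f_inj[];
    try by move=> /e_inj.
  - by move=> /j_inj ->.
  - by move=> /f_inj[/IH1 -> /IH2 ->].
  - by move=> /IH ->.
exists (fun p => let: Eqn w1 w2 := p in f (code w1, code w2)).
by move=> [w1 w2] [v1 v2] /f_inj[/code_inj -> /code_inj ->].
Qed.

Section Generated.
Variable G : groupType.
Implicit Types S B : set G.

Lemma generated_subgroup S : is_subgroup (generated S).
Proof.
split=> [B [[]]//|x y Sx Sy B BS|x Sx B BS].
- by have [[_ BM _] _] := BS; exact: BM (Sx _ BS) (Sy _ BS).
- by have [[_ _ BV] _] := BS; exact: BV (Sx _ BS).
Qed.

Lemma sub_generated S : S `<=` generated S.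
Proof. by move=> x Sx B [_]; exact. Qed.

Lemma generated_sub S B : is_subgroup B -> S `<=` B -> generated S `<=` B.
Proof. by move=> HB SB x; apply. Qed.

Lemma locally_finiteP :
  locally_finite G <-> forall S, finite_set S -> finite_set (generated S).
Proof.
split=> [lfG S Sfin|genfin H _ [S Sfin ->]]; last exact: genfin.
by apply: lfG; [exact: generated_subgroup|exists S].
Qed.

(* Every element of the subgroup is a product of generators and inverses of
   generators, hence is named by a finite sequence. *)
Lemma generated_card_inj (T M : Type) (a : T -> G) (S : set G) :
  infinite_set [set: M] -> (exists f : T -> M, injective f) -> S `<=` range a ->
  exists f : G -> M, forall x y, generated S x -> generated S y -> f x = f y -> x = y.
Proof.
move=> Moo TM Sa; have [e e_inj] := infinite_nat_inj Moo.
have [|c c_inj] := @card_seq_inj (bool * T) M Moo.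
  apply: card_prod_inj => //; exists (fun b : bool => e b).
  by case=> [] [] // /e_inj.
pose ev (s : seq (bool * T)) :=
  (\prod_(p <- s) (if p.1 then a p.2 else (a p.2)^-1))%g.
have evP : generated S `<=` range ev.
  apply: generated_sub; last first.
    by move=> x /Sa [t _ <-]; exists [:: (true, t)]; rewrite // /ev big_seq1.
  split; first by exists [::]; rewrite // /ev big_nil.
  - by move=> _ _ [s _ <-] [t _ <-]; exists (s ++ t); rewrite // /ev big_cat.
  - move=> _ [s _ <-]; exists (rev [seq (~~ p.1, p.2) | p <- s]) => //.
    elim: s => [|[b t] s IHs] /=; first by rewrite /ev !big_nil invg1.
    rewrite /ev rev_cons -cats1 big_cat big_seq1 big_cons invgM -/(ev _) IHs /=.
    by congr (_ * _)%g; case: b; rewrite //= invgK.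
have /choice[s sP] : forall x, exists s, generated S x -> ev s = x.
  move=> x; have [/evP[s _ <-]|] := pselect (generated S x); first by exists s.
  by exists [::].
exists (c \o s) => x y /sP {2}<- /sP {2}<- /c_inj -> //.
Qed.

End Generated.

(** By induction on [js]: Y is the union of the fibres of one projection over its finitely many
    values, and the other projections separate the points of each fibre. *)
Lemma finite_set_proj (T : Type) (J : eqType) (U : J -> Type)
    (pi : forall j, T -> U j) (js : seq J) (Y : set T) :
  (forall j, j \in js -> finite_set (pi j @` Y)) ->
  (forall x y, Y x -> Y y -> (forall j, j \in js -> pi j x = pi j y) -> x = y) ->
  finite_set Y.
Proof.
elim: js Y => [|j js IHjs] Y pifin pi_inj.
  have [->|/set0P[y Yy]] := eqVneq Y set0; first exact: finite_set0.
  apply: (@sub_finite_set _ _ [set y]); last exact: finite_set1.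
  by move=> x Yx; apply: pi_inj.
pose F u := Y `&` [set x | pi j x = u].
apply: (@sub_finite_set _ _ (\bigcup_(u in pi j @` Y) F u)).
  by move=> x Yx; exists (pi j x) => //; exists x.
apply: bigcup_finite => [|u _]; first by apply: pifin; rewrite mem_head.
apply: IHjs => [l ljs|x y [Yx xu] [Yy yu] xy].
  apply: sub_finite_set (pifin l _); last by rewrite inE ljs orbT.
  by move=> _ [x [Yx _] <-]; exists x.
apply: pi_inj => // l; rewrite inE => /orP[/eqP->|]; last exact: xy.
by rewrite [LHS]xu [RHS]yu.
Qed.

(** The subgroup generated by s stays inside B, where finitely many projections determine an
    element; each of them sends it into a finitely generated, hence finite, subgroup. This serves
    both for the almost diagonal tuples and for the functions on the cube. *)
Lemma locally_finite_proj (G : groupType) (J : eqType) (H : J -> groupType)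
    (pi : forall j, G -> H j) :
  (forall j, {morph pi j : x y / (x * y)%g}) ->
  (forall j, locally_finite (H j)) ->
  (forall s : seq G, exists (js : seq J) (B : set G),
     [/\ is_subgroup B, forall x, x \in s -> B x &
       forall x y, B x -> B y -> (forall j, j \in js -> pi j x = pi j y) -> x = y]) ->
  locally_finite G.
Proof.
move=> piM lfH GB; apply/locally_finiteP => S /finite_seqP[s ->{S}].
have [js [B [HB sB pi_inj]]] := GB s.
have genB := generated_sub HB sB.
apply: (@finite_set_proj _ _ _ pi js) => [j _|x y /genB Bx /genB By]; last exact: pi_inj.
have /locally_finiteP/(_ (pi j @` [set` s])) lf := lfH j.
apply: sub_finite_set (lf _); last by apply: finite_image; exact: finite_seq.
move=> _ [x Gx <-]; move: x Gx; apply: generated_sub.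
  by apply: preimage_subgroup => //; exact: generated_subgroup.
by move=> x sx; apply: sub_generated; exists x.
Qed.

(** * Products and subgroups as groups *)

Section ProductGroup.
Variables (J : Type) (G : J -> groupType).

Definition prod_group := forall j, G j.

HB.instance Definition _ := gen_eqMixin prod_group.
HB.instance Definition _ := gen_choiceMixin prod_group.

Program Definition prod_group_isGroup := @isGroup.Build prod_group
  (fun=> 1%g) (fun x j => (x j)^-1)%g (fun x y j => x j * y j)%g _ _ _ _ _.
Next Obligation. by move=> x y z; apply: functional_extensionality_dep => j; rewrite mulgA. Qed.
Next Obligation. by move=> x; apply: functional_extensionality_dep => j; rewrite mul1g. Qed.
Next Obligation. by move=> x; apply: functional_extensionality_dep => j; rewrite mulg1. Qed.
Next Obligation. by move=> x; apply: functional_extensionality_dep => j; rewrite mulVg. Qed.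
Next Obligation. by move=> x; apply: functional_extensionality_dep => j; rewrite mulgV. Qed.

HB.instance Definition _ := prod_group_isGroup.

End ProductGroup.

Section SubgroupType.
Variables (G : groupType) (B : set G) (HB : is_subgroup B).

(** The closure proof is a parameter of the type, so that the group instance below can be attached
    to it. *)
Definition subgroup_type of is_subgroup B := {x : G | x \in B}.
Local Notation T := (subgroup_type HB).

Definition to_subgroup x (Bx : B x) : T := exist _ x (mem_set Bx).
Definition of_subgroup (x : T) : G := sval x.

Lemma of_subgroupP x : B (of_subgroup x).
Proof. by case: x => x /= /set_mem. Qed.

Lemma of_subgroup_inj : injective of_subgroup.
Proof. exact: val_inj. Qed.

HB.instance Definition _ := gen_eqMixin T.
HB.instance Definition _ := gen_choiceMixin T.

Let one : T := let: And3 B1 _ _ := HB in to_subgroup B1.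
Let mul (x y : T) : T :=
  let: And3 _ BM _ := HB in to_subgroup (BM _ _ (of_subgroupP x) (of_subgroupP y)).
Let inv (x : T) : T :=
  let: And3 _ _ BV := HB in to_subgroup (BV _ (of_subgroupP x)).

Let val1 : of_subgroup one = 1%g.
Proof. by rewrite /one; case: HB. Qed.
Let valM x y : of_subgroup (mul x y) = (of_subgroup x * of_subgroup y)%g.
Proof. by rewrite /mul; case: HB. Qed.
Let valV x : of_subgroup (inv x) = ((of_subgroup x)^-1)%g.
Proof. by rewrite /inv; case: HB. Qed.

Program Definition subgroup_type_isGroup := @isGroup.Build T one inv mul _ _ _ _ _.
Next Obligation. by move=> x y z; apply: of_subgroup_inj; rewrite !valM mulgA. Qed.
Next Obligation. by move=> x; apply: of_subgroup_inj; rewrite !valM val1 mul1g. Qed.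
Next Obligation. by move=> x; apply: of_subgroup_inj; rewrite !valM val1 mulg1. Qed.
Next Obligation. by move=> x; apply: of_subgroup_inj; rewrite !valM valV val1 mulVg. Qed.
Next Obligation. by move=> x; apply: of_subgroup_inj; rewrite !valM valV val1 mulgV. Qed.

HB.instance Definition _ := subgroup_type_isGroup.

Lemma of_subgroupM : {morph of_subgroup : x y / (x * y)%g}.
Proof. exact: valM. Qed.

End SubgroupType.

(** * Moving all movable elements in one extension *)

Definition movable (G1 G2 : groupType) (i : G1 -> G2) (c : G2) : Prop :=
  exists (H : groupType) (k : {multiplicative G2 -> H}) (b : H),
    [/\ injective k, locally_finite H, b <> k c &
        realizes_at (k \o i) (tp_at i (seq1 c)) (seq1 b)].

Section AlmostDiagonal.
Variables (G1 G2 : groupType) (i : {multiplicative G1 -> G2}).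
Variables (H : G2 -> groupType) (k : forall c, {multiplicative G2 -> H c}).
Variable b : forall c, H c.
Hypothesis k_inj : forall c, injective (k c).
Hypothesis lfH : forall c, locally_finite (H c).
Hypothesis bP : forall c, realizes_at (k c \o i) (tp_at i (seq1 c)) (seq1 (b c)).

Definition diag (g : G2) : prod_group H := fun c => k c g.
Definition moved (c : G2) : prod_group H := dfwith (diag c) (b c).

Definition almost_diag (F : seq G2) : set (prod_group H) :=
  [set x | exists g, forall c, c \notin F -> x c = k c g].

Lemma almost_diag_subgroup F : is_subgroup (almost_diag F).
Proof.
split=> [|x y [g xg] [h yh]|x [g xg]].
- by exists 1%g => c _; rewrite (morph_mul1 (@gmulfM _ _ (k c))).
- by exists (g * h)%g => c cF; rewrite gmulfM -xg// -yh.
- by exists (g^-1)%g => c cF; rewrite (morph_mulV (@gmulfM _ _ (k c))) -xg.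
Qed.

Lemma almost_diagS F F' : {subset F <= F'} -> almost_diag F `<=` almost_diag F'.
Proof.
move=> FF' x [g xg]; exists g => c cF'.
by apply: xg; apply: contra cF'; exact: FF'.
Qed.

Definition gens : set (prod_group H) := range diag `|` range moved.
Definition diag_closure : groupType := subgroup_type (generated_subgroup gens).

Lemma generated_almost_diag x : generated gens x -> exists F, almost_diag F x.
Proof.
apply: (@generated_sub _ _ [set x | exists F, almost_diag F x]) => [|_ [[g _ <-]|[c _ <-]]]; last 2 first.
- by exists [::], g.
- exists [:: c], c => c'; rewrite inE eq_sym => cc'.
  by rewrite /moved dfwith_out.
split=> [|u v [F Fu] [F' F'v]|u [F Fu]].
- by exists [::]; have [] := almost_diag_subgroup [::].
- exists (F ++ F'); have [_ + _] := almost_diag_subgroup (F ++ F'); apply.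
    by apply: almost_diagS Fu => c; rewrite mem_cat => ->.
  by apply: almost_diagS F'v => c; rewrite mem_cat orbC => ->.
- by exists F; have [_ _] := almost_diag_subgroup F; apply.
Qed.

Lemma diag_closure_lf : locally_finite diag_closure.
Proof.
apply: (@locally_finite_proj diag_closure G2 H (fun c x => of_subgroup x c)) => [c x y|//|s].
  by rewrite of_subgroupM.
have /choice[F FP] : forall x : diag_closure, exists F, almost_diag F (of_subgroup x).
  by move=> x; apply: generated_almost_diag; exact: of_subgroupP.
pose Fs := flatten [seq F x | x <- s].
(* One coordinate outside [Fs], when there is one, recovers the diagonal part g by injectivity of
   [k d]; if there is none, [Fs] already lists all coordinates. *)
have [js [Fjs js_out]] : exists js : seq G2, {subset Fs <= js} /\
    ((exists c, c \notin Fs) -> exists2 c, c \in js & c \notin Fs).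
  have [[c cFs]|nFs] := pselect (exists c, c \notin Fs); last by exists Fs; split=> [c|/nFs].
  exists (c :: Fs); split=> [d dFs|_]; first by rewrite inE dFs orbT.
  by exists c; rewrite ?mem_head.
exists js, (@of_subgroup _ _ _ @^-1` almost_diag Fs); split.
- apply: preimage_subgroup; first exact: of_subgroupM.
  exact: almost_diag_subgroup.
- move=> x sx; apply: almost_diagS (FP x) => c Fc.
  by apply/flattenP; exists (F x) => //; apply/mapP; exists x.
- move=> x y [g xg] [h yh] xy; apply: of_subgroup_inj.
  apply: functional_extensionality_dep => c.
  have [/Fjs/xy//|cFs] := boolP (c \in Fs).
  have [|d djs dFs] := js_out; first by exists c.
  have gh : g = h by apply: (@k_inj d); rewrite -xg// -yh//; apply: xy.
  by rewrite xg// yh// gh.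
Qed.

Lemma diag_closure_card (M : Type) : infinite_set [set: M] ->
  (exists f : G2 -> M, injective f) -> exists f : diag_closure -> M, injective f.
Proof.
move=> Moo G2M; have [e e_inj] := infinite_nat_inj Moo.
have [||f f_inj] := @generated_card_inj _ (bool * G2) M
    (fun p => if p.1 then diag p.2 else moved p.2) gens Moo.
- apply: card_prod_inj => //; exists (fun b : bool => e b).
  by case=> [] [] // /e_inj.
- by move=> _ [[g _ <-]|[g _ <-]]; [exists (true, g)|exists (false, g)].
exists (f \o @of_subgroup _ _ _) => x y /f_inj fxy.
by apply/of_subgroup_inj/fxy; exact: of_subgroupP.
Qed.

Lemma gens_diag g : generated gens (diag g).
Proof. by apply: sub_generated; left; exists g. Qed.

Lemma gens_moved c : generated gens (moved c).
Proof. by apply: sub_generated; right; exists c. Qed.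

Definition diag_emb (g : G2) : diag_closure := to_subgroup _ (gens_diag g).

Lemma diag_embM : {morph diag_emb : x y / (x * y)%g}.
Proof.
move=> x y; apply/of_subgroup_inj; apply: functional_extensionality_dep => c.
by rewrite of_subgroupM /= /diag gmulfM.
Qed.

HB.instance Definition _ := isMultiplicative.Build _ _ diag_emb diag_embM.

Lemma diag_emb_inj : injective diag_emb.
Proof.
by move=> x y /(congr1 (fun z : diag_closure => of_subgroup z x)) /k_inj.
Qed.

(** Equations are checked coordinatewise: coordinate c holds the chosen realization [b c], and every
    other coordinate d holds the image of c under [k d]. *)
Lemma moved_realizes c :
  realizes_at (diag_emb \o i) (tp_at i (seq1 c)) (seq1 (to_subgroup _ (gens_moved c))).
Proof.
move=> [w1 w2] cw /=; apply/of_subgroup_inj.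
apply: functional_extensionality_dep => d.
have evM : {morph (fun x : diag_closure => of_subgroup x d) : x y / (x * y)%g}.
  by move=> x y; rewrite of_subgroupM.
rewrite !(morph_weval evM).
have [<-|dc] := eqVneq c d.
  have -> : (fun x : diag_closure => of_subgroup x c) \o
      seq1 (to_subgroup _ (gens_moved c)) = seq1 (b c).
    by apply: funext => -[]; rewrite /= /moved dfwith_in.
  exact: (bP cw).
have -> : (fun x : diag_closure => of_subgroup x d) \o
    seq1 (to_subgroup _ (gens_moved c)) = k d \o seq1 c.
  by apply: funext => -[]; rewrite /= /moved dfwith_out.
exact: (morph_sat_at (@gmulfM _ _ (k d)) cw).
Qed.

End AlmostDiagonal.

Lemma exists_moving_extension (M : Type) (G1 G2 : groupType)
    (i : {multiplicative G1 -> G2}) :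
  infinite_set [set: M] -> (exists f : G2 -> M, injective f) ->
  locally_finite G2 ->
  exists (K : groupType) (k : {multiplicative G2 -> K}),
    [/\ injective k, locally_finite K, exists f : K -> M, injective f &
      forall c, movable i c -> exists2 b : K, b <> k c &
        realizes_at (k \o i) (tp_at i (seq1 c)) (seq1 b)].
Proof.
move=> Moo G2M lfG2.
(* For c not movable, the dummy choice of [G2], the identity and c itself makes the hypotheses on
   the factors hold at every index. *)
have wit (c : G2) : {H : groupType & {k : {multiplicative G2 -> H} & {b : H |
    [/\ injective k, locally_finite H, movable i c -> b <> k c &
        realizes_at (k \o i) (tp_at i (seq1 c)) (seq1 b)]}}}.
  have [mc|nmc] := pselect (movable i c).
    have /cid[H /cid[k /cid[b [kinj lfH bc bP]]]] := mc.
    by exists H, k, b.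
  by exists G2, idfun, c; split.
pose H c := projT1 (wit c).
pose k c : {multiplicative G2 -> H c} := projT1 (projT2 (wit c)).
pose b c : H c := sval (projT2 (projT2 (wit c))).
have wP c : [/\ injective (k c), locally_finite (H c), movable i c -> b c <> k c c &
    realizes_at (k c \o i) (tp_at i (seq1 c)) (seq1 (b c))].
  exact: (svalP (projT2 (projT2 (wit c)))).
have k_inj c : injective (k c) by have [] := wP c.
have lfH c : locally_finite (H c) by have [] := wP c.
have bc c : movable i c -> b c <> k c c by have [] := wP c.
have bP c : realizes_at (k c \o i) (tp_at i (seq1 c)) (seq1 (b c)) by have [] := wP c.
exists (diag_closure k b), (diag_emb k b); split.
- exact: diag_emb_inj.
- exact: diag_closure_lf.
- exact: diag_closure_card.
- move=> c /bc bcc; exists (to_subgroup _ (gens_moved c)); last exact: moved_realizes.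
  move=> /(congr1 (fun z : diag_closure k b => of_subgroup z c)).
  by rewrite /= /moved dfwith_in.
Qed.

(** * Locally constant functions on a cube *)

Section CubePower.
Variables (W : choiceType) (G K : groupType) (k : {multiplicative G -> K}).

Definition cube := W -> bool.
Definition origin : cube := fun=> false.

Definition depends_on (T : Type) (s : seq W) (f : cube -> T) : Prop :=
  forall x y : cube, (forall t, t \in s -> x t = y t) -> f x = f y.

Lemma depends_onS (T : Type) (s s' : seq W) (f : cube -> T) :
  {subset s <= s'} -> depends_on s f -> depends_on s' f.
Proof. by move=> ss' fs x y xy; apply: fs => t /ss'; exact: xy. Qed.

Definition set_coord (x : cube) (t : W) (b : bool) : cube :=
  fun t' => if t' == t then b else x t'.

Definition indifferent (T : Type) (t : W) (f : cube -> T) : Prop :=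
  forall x b, f (set_coord x t b) = f x.

Lemma depends_on_indifferent (T : Type) (s : seq W) (f : cube -> T) t :
  depends_on s f -> t \notin s -> indifferent t f.
Proof.
move=> fs ts x b; apply: fs => t' t's; rewrite /set_coord.
by case: eqP => // tt'; rewrite -tt' t's in ts.
Qed.

(** Off [s] the index equals the length of the tuple, so the default false applies. These finitely
    many points test every function that depends on [s] only. *)
Definition grid_point (s : seq W) (b : (size s).-tuple bool) : cube :=
  fun t => nth false b (index t s).

Lemma depends_on_grid (T : Type) (s : seq W) (f g : cube -> T) :
  depends_on s f -> depends_on s g ->
  (forall b : (size s).-tuple bool, f (grid_point b) = g (grid_point b)) -> f = g.
Proof.
move=> fs gs fg; apply: funext => x.
pose b := [tuple of map_tuple x (in_tuple s)].
have xb t : t \in s -> x t = grid_point b t.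
  by move=> ts; rewrite /grid_point /= (nth_map t) ?index_mem// nth_index.
by rewrite (fs x (grid_point b) xb) fg (gs x (grid_point b) xb).
Qed.

(** The condition at the origin ensures that the constant map with value f(origin) comes from [G];
    away from the origin all of [K] is allowed, which leaves room for moved copies. *)
Definition cube_maps : set (prod_group (fun _ : cube => K)) :=
  [set f | (exists s, depends_on s f) /\ range k (f origin)].

Definition dependent_maps s : set (prod_group (fun _ : cube => K)) :=
  [set f | depends_on s f].

Lemma depends_on_subgroup s : is_subgroup (dependent_maps s).
Proof.
split=> [x y //|f g fs gs x y xy|f fs x y xy].
- by congr (_ * _)%g; [exact: fs|exact: gs].
- by congr (_^-1)%g; exact: fs.
Qed.

Lemma cube_maps_subgroup : is_subgroup cube_maps.
Proof.
split=> [|f g [[s fs] [a _ fa]] [[t gt] [b _ gb]]|f [[s fs] [a _ fa]]].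
- split; first by exists [::].
  by exists 1%g => //; rewrite (morph_mul1 (@gmulfM _ _ k)).
- split.
    have [_ M _] := depends_on_subgroup (s ++ t); exists (s ++ t); apply: M.
      by apply: depends_onS fs => w; rewrite mem_cat => ->.
    by apply: depends_onS gt => w; rewrite mem_cat orbC => ->.
  by exists (a * b)%g => //; rewrite gmulfM fa gb.
- split; first by exists s; have [_ _] := depends_on_subgroup s; apply.
  by exists (a^-1)%g => //; rewrite (morph_mulV (@gmulfM _ _ k)) fa.
Qed.

Definition cube_power : groupType := subgroup_type cube_maps_subgroup.

Definition cube_ev (x : cube) (f : cube_power) : K := of_subgroup f x.

Lemma cube_evM x : {morph cube_ev x : f g / (f * g)%g}.
Proof. by move=> f g; rewrite /cube_ev of_subgroupM. Qed.

Lemma cube_ext (f g : cube_power) : cube_ev^~ f =1 cube_ev^~ g -> f = g.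
Proof. by move=> fg; apply: of_subgroup_inj; apply: funext. Qed.

Lemma cube_support (f : cube_power) : exists s, depends_on s (cube_ev^~ f).
Proof. by have [] := of_subgroupP f. Qed.

Lemma cube_origin (f : cube_power) : exists g, cube_ev origin f = k g.
Proof. by have [_ [g _ fg]] := of_subgroupP f; exists g. Qed.

Lemma cube_const_subproof (g : G) : cube_maps (fun=> k g).
Proof. by split; [exists [::]|exists g]. Qed.

Definition cube_const (g : G) : cube_power := to_subgroup _ (cube_const_subproof g).

Lemma cube_ev_const x g : cube_ev x (cube_const g) = k g.
Proof. by []. Qed.

Lemma cube_constM : {morph cube_const : x y / (x * y)%g}.
Proof.
by move=> g h; apply: cube_ext => x; rewrite cube_evM !cube_ev_const gmulfM.
Qed.

HB.instance Definition _ := isMultiplicative.Build _ _ cube_const cube_constM.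

Lemma cube_const_inj : injective k -> injective cube_const.
Proof. by move=> k_inj g h /(congr1 (cube_ev origin)) /k_inj. Qed.

Lemma cube_mix_subproof (t : W) (f : cube -> K) (g : cube_power) :
  (exists s, depends_on s f) ->
  cube_maps (fun x => if x t then f x else cube_ev x g).
Proof.
move=> [s fs]; have [s' gs'] := cube_support g; split.
  exists (t :: s ++ s') => x y xy; rewrite xy ?mem_head//.
  case: ifP => _; [apply: fs|apply: gs'] => w ws; apply: xy.
    by rewrite inE mem_cat ws orbT.
  by rewrite inE mem_cat ws !orbT.
by have [a ga] := cube_origin g; exists a.
Qed.

(* At the origin the mix agrees with g, so no condition on f is needed there. *)
Definition cube_mix t f g fs : cube_power :=
  to_subgroup _ (@cube_mix_subproof t f g fs).

Definition mix (t : W) (f g : cube_power) := cube_mix t g (cube_support f).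

Lemma cube_ev_mix x t f g :
  cube_ev x (mix t f g) = if x t then cube_ev x f else cube_ev x g.
Proof. by []. Qed.

Lemma cube_power_lf : locally_finite K -> locally_finite cube_power.
Proof.
move=> lfK.
apply: (@locally_finite_proj cube_power cube (fun=> K) cube_ev) => //.
  exact: cube_evM.
move=> s; have /choice[S SP] := cube_support.
pose Ss := flatten [seq S f | f <- s].
exists [seq grid_point b | b : (size Ss).-tuple bool].
exists (@of_subgroup _ _ _ @^-1` dependent_maps Ss); split.
- apply: preimage_subgroup; first exact: of_subgroupM.
  exact: depends_on_subgroup.
- move=> f sf; apply: depends_onS (SP f) => t St.
  by apply/flattenP; exists (S f) => //; apply/mapP; exists f.
- move=> f g fS gS fg; apply: of_subgroup_inj.
  apply: (depends_on_grid fS gS) => b; apply: fg.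
  by apply/mapP; exists b; rewrite ?mem_enum.
Qed.

(** A map is coded by a support together with the finite table of its values at the grid points of
    that support. *)
Lemma cube_power_card (M : Type) : infinite_set [set: M] ->
  (exists f : W -> M, injective f) -> (exists f : K -> M, injective f) ->
  exists f : cube_power -> M, injective f.
Proof.
move=> Moo WM KM.
have [|c c_inj] := @card_prod_inj (seq W) (seq K) M Moo (card_seq_inj Moo WM).
  exact: card_seq_inj.
have /choice[S SP] := cube_support.
pose table s (f : cube_power) := [seq cube_ev (grid_point b) f | b : (size s).-tuple bool].
exists (fun f => c (S f, table (S f) f)) => f g /c_inj[Sfg].
rewrite -Sfg => /eq_in_map fg; apply: of_subgroup_inj.
apply: (@depends_on_grid _ (S f)); first exact: SP.
  by rewrite Sfg; exact: SP.
by move=> b; apply: fg; rewrite mem_enum.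
Qed.

Section Realizations.
Variables (G0 : groupType) (i : G0 -> G) (A : Type).
Let i' := cube_const \o i.
Implicit Types a : A -> cube_power.

Definition slice (x : cube) a : A -> K := cube_ev x \o a.

Lemma slice_sat_at a p : sat_at i' a p <-> forall x, sat_at (k \o i) (slice x a) p.
Proof.
case: p => w1 w2; split=> [E x|E].
  exact: (morph_sat_at (@cube_evM x) (p := Eqn w1 w2) E).
apply: cube_ext => x; rewrite !(morph_weval (@cube_evM x)); exact: E.
Qed.

Lemma mix_sat_at t a a' p : sat_at i' a p -> sat_at i' a' p ->
  sat_at i' (fun v => mix t (a v) (a' v)) p.
Proof.
rewrite !slice_sat_at => ap a'p x; have {ap a'p} := (ap x, a'p x).
have -> : slice x (fun v => mix t (a v) (a' v)) = if x t then slice x a else slice x a'.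
  by apply: funext => v; rewrite /slice /comp cube_ev_mix; case: ifP.
by case: ifP => _ [].
Qed.

(** Setting coordinate t to true turns the mix into a and leaves the values of a unchanged. Hence
    the mix also inherits the negated equations of a, which lifts atomic types to basic types. *)
Lemma mix_sat_at_inv t a a' p :
  (forall v, indifferent t (cube_ev^~ (a v))) ->
  sat_at i' (fun v => mix t (a v) (a' v)) p -> sat_at i' a p.
Proof.
move=> fresh; rewrite !slice_sat_at => + x => /(_ (set_coord x t true)).
congr sat_at; apply: funext => v; rewrite /slice /comp cube_ev_mix /set_coord eqxx.
exact: fresh.
Qed.

End Realizations.

End CubePower.

(** * Delta-systems and rigid elements *)

(** The family is indexed by [B * nat], which injects into L, so it cannot exhaust the subsets of
    L. *)
Lemma exists_fresh_set (L B : Type) (S : B -> nat -> set L) :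
  infinite_set [set: L] -> (exists f : B -> L, injective f) ->
  exists p, forall v n, S v n <> p.
Proof.
move=> Loo BL; have [|f f_inj] := @card_prod_inj B nat L Loo BL.
  exact: infinite_nat_inj.
apply: contrapT => nofresh.
have /choice[q qP] : forall p, exists vn, S vn.1 vn.2 = p.
  move=> p; apply: contrapT => np; apply: nofresh; exists p => v n Svn.
  by apply: np; exists (v, n).
apply: (@no_inj_set L (f \o q)) => x y /f_inj qxy.
by rewrite -(qP x) -(qP y) qxy.
Qed.

Section DeltaSystems.
Variables (L M : Type) (G1 G2 K : groupType).
Variables (i : {multiplicative G1 -> G2}) (k : {multiplicative G2 -> K}).
Hypothesis Loo : infinite_set [set: L].

(** Each subset of L is the label of a column with one coordinate [Some m] for every m in M, to
    separate the members of a Delta-system, and one extra coordinate [None]. There are 2^lambda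
    columns, too many for lambda finite supports to meet them all. *)
Definition coord := {classic option M * set L}.
Notation G3 := (cube_power coord k).
Let i13 : G1 -> G3 := @cube_const coord _ _ k \o i.

Lemma exists_fresh_coord (A : Type) (a : nat -> A -> G3) :
  (exists f : A -> L, injective f) ->
  exists t : option M -> coord, injective t /\
    forall m n v, indifferent (t m) ((@cube_ev _ _ _ k)^~ (a n v)).
Proof.
move=> AL; have [f f_inj] := card_prod_inj Loo (infinite_nat_inj Loo) AL.
have /choice[S SP] := @cube_support coord _ _ k.
(* For each map, [nth] lists the columns met by its support; past the end it returns the default
   column [set0], which p then avoids as well. *)
have [|p pP] := @exists_fresh_set L (nat * A)
  (fun v n => (nth ((None, set0) : coord) (S (a v.1 v.2)) n).2) Loo; first by exists f.
exists (fun m => (m, p)); split=> [m m' [] //|m n v].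
apply: (depends_on_indifferent (SP _)); apply/negP => tS.
by have := pP (n, v) (index ((m, p) : coord) (S (a n v))); rewrite /= nth_index.
Qed.

Lemma exists_delta_system (A : Type) (a a' a'' : A -> G3) :
  (exists f : A -> L, injective f) -> (exists f : G3 -> M, injective f) ->
  realizes_at i13 (tp_at i13 a) a' -> realizes_at i13 (tp_at i13 a) a'' ->
  exists s : G3 -> A -> G3,
    delta_system_along a [set v | a' v = a'' v] s /\
    forall e, realizes_at i13 (tp_at i13 a) (s e) /\
              realizes_bs i13 (tp_bs i13 a) (s e).
Proof.
move=> AL [j j_inj] a'P a''P.
have [t [t_inj tP]] := exists_fresh_coord (fun n => nth a [:: a; a'; a''] n) AL.
have ta m v := tP m 0 v; have ta' m v := tP m 1 v; have ta'' m v := tP m 2 v.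
rewrite /= in ta ta' ta''.
(* The outer coordinate exhibits [a], which secures the basic type; the inner one, private to e,
   chooses between [a'] and [a'']. *)
pose s e v := mix (t None) (a v) (mix (t (Some (j e))) (a' v) (a'' v)).
have s_at e : realizes_at i13 (tp_at i13 a) (s e).
  move=> p ap; apply: mix_sat_at => //; apply: mix_sat_at; [exact: a'P|exact: a''P].
have eq_a b v w : realizes_at i13 (tp_at i13 a) b -> a v = a w -> b v = b w.
  by move=> /(_ (Eqn (WVar _ v) (WVar _ w))); apply.
exists s; split=> [e1 e2 v w|e]; last first.
  split=> // -[p ap|p nap]; first exact: s_at.
  by apply: contra_not nap; apply: mix_sat_at_inv.
split=> [E|[[-> avw]|[avw uv]]]; last 2 first.
- exact: eq_a (s_at e2) avw.
- have avw' := eq_a _ _ _ a'P avw; have avw'' := eq_a _ _ _ a''P avw.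
  apply: cube_ext => x; rewrite !cube_ev_mix avw -avw' -avw'' -uv.
  by do 2! case: (x (t (Some _))).
(* Where [t None] is true both sides show [a], so equal entries force the same repetition in [a]. *)
have avw : a v = a w.
  apply: cube_ext => x; move/(congr1 (cube_ev (set_coord x (t None) true))): E.
  by rewrite !cube_ev_mix /set_coord eqxx -!/(set_coord _ _ _) !ta.
have [->|/eqP e12] := pselect (e1 = e2); first by left.
right; split=> //=; rewrite (eq_a _ _ _ a''P avw).
apply: cube_ext => x.
(* At y the sequence of index e1 shows [a'] and that of index e2 shows [a'']; both have the same
   values at y as at x, by freshness of the three changed coordinates. *)
pose y := set_coord (set_coord (set_coord x (t None) false)
  (t (Some (j e1))) true) (t (Some (j e2))) false.
have t_neq m m' : m <> m' -> (t m == t m') = false.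
  by move=> mm'; apply/eqP => /t_inj.
have y0 : y (t None) = false by rewrite /y /set_coord eqxx !t_neq.
have y1 : y (t (Some (j e1))) = true.
  by rewrite /y /set_coord eqxx t_neq// => -[] /j_inj; exact/eqP.
have y2 : y (t (Some (j e2))) = false by rewrite /y /set_coord eqxx.
move/(congr1 (cube_ev y)): E; rewrite !cube_ev_mix y0 y1 y2.
by rewrite /y !ta' !ta''.
Qed.

(** A single fresh coordinate selects the pair a', a'' when true and the pair b', b'' when false;
    the two mixes agree at v exactly when both pairs do. *)
Lemma agreement_setI (A : Type) (a a' a'' b' b'' : A -> G3) :
  (exists f : A -> L, injective f) ->
  realizes_at i13 (tp_at i13 a) a' -> realizes_at i13 (tp_at i13 a) a'' ->
  realizes_at i13 (tp_at i13 a) b' -> realizes_at i13 (tp_at i13 a) b'' ->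
  exists c' c'' : A -> G3,
    [/\ realizes_at i13 (tp_at i13 a) c', realizes_at i13 (tp_at i13 a) c'' &
      [set v | a' v = a'' v] `&` [set v | b' v = b'' v] = [set v | c' v = c'' v]].
Proof.
move=> AL a'P a''P b'P b''P.
have [t [_ tP]] := exists_fresh_coord (fun n => nth a [:: a'; a''; b'; b''] n) AL.
pose t0 := t None.
have ta' v := tP None 0 v; have ta'' v := tP None 1 v.
have tb' v := tP None 2 v; have tb'' v := tP None 3 v.
rewrite /= in ta' ta'' tb' tb''.
exists (fun v => mix t0 (a' v) (b' v)), (fun v => mix t0 (a'' v) (b'' v)); split.
- by move=> p ap; apply: mix_sat_at; [exact: a'P|exact: b'P].
- by move=> p ap; apply: mix_sat_at; [exact: a''P|exact: b''P].
apply/seteqP; split=> [v [/= -> ->] //|v /= E].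
have ev x := congr1 (cube_ev x) E.
split; apply: cube_ext => x.
- have := ev (set_coord x t0 true); rewrite !cube_ev_mix /set_coord eqxx.
  by rewrite -!/(set_coord _ _ _) ta' ta''.
- have := ev (set_coord x t0 false); rewrite !cube_ev_mix /set_coord eqxx.
  by rewrite -!/(set_coord _ _ _) tb' tb''.
Qed.

Definition rigid_elements : set G3 :=
  [set c | forall b, realizes_at i13 (tp_at i13 (seq1 c)) (seq1 b) -> b = c].

(** A rigid element is determined by its atomic type, which is coded as a subset of L. *)
Lemma rigid_card : (exists f : G1 -> L, injective f) ->
  rigid_elements #<= [set: set L].
Proof.
move=> /(atomic_card_inj Loo)[f f_inj].
apply: (@inj_on_card_le _ _ _ _ (fun c => f @` tp_at i13 (seq1 c))) => // b c _ rc bc.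
apply: rc => p /= cp.
have [q bq /f_inj <-] : (f @` tp_at i13 (seq1 b)) (f p) by rewrite bc; exists p.
exact: bq.
Qed.

(** A Delta-system of sequences of length one is built from c and another realization b. Since c and
    b differ, its heart is empty and its members are pairwise distinct. *)
Lemma not_rigid_card (c : G3) : (exists f : G3 -> M, injective f) ->
  ~ rigid_elements c ->
  [set b : G3 | realizes_bs i13 (tp_bs i13 (seq1 c)) (seq1 b)] #= [set: G3].
Proof.
move=> G3M nrc.
have [b] : exists b, ~ (realizes_at i13 (tp_at i13 (seq1 c)) (seq1 b) -> b = c).
  exact/existsNP.
move=> /not_implyP[bP bc].
have UL : exists f : unit -> L, injective f.
  by have [e _] := infinite_nat_inj Loo; exists (fun=> e 0) => -[] [].
have [|s [sD sP]] := exists_delta_system UL G3M (a := seq1 c) (a' := seq1 c) _ bP.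
  by [].
rewrite card_eq_le; apply/andP; split; first exact: card_leT.
have s_inj e1 e2 : s e1 tt = s e2 tt -> e1 = e2.
  by move=> /sD[[]//|[_ /= cb]]; case: bc.
apply: (@inj_on_card_le _ _ _ _ (fun e => s e tt)) => [e _ /=|e1 e2 _ _].
  have -> : seq1 (s e tt) = s e by apply: funext => -[].
  by have [] := sP e.
exact: s_inj.
Qed.

Hypothesis k_inj : injective k.
Hypothesis moving : forall c, movable i c -> exists2 b : K, b <> k c &
  realizes_at (k \o i) (tp_at i (seq1 c)) (seq1 b).

Lemma rigid_not_movable c : rigid_elements c ->
  exists2 g, c = cube_const coord k g & ~ movable i g.
Proof.
move=> rc; have [g cg] := cube_origin c.
have gc : cube_const coord k g = c.
  apply: rc => p /slice_sat_at /(_ (@origin _)) cp; apply/slice_sat_at => x.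
  by move: cp; rewrite /slice /comp /seq1 cg.
exists g => // /moving[b bg bP].
(* Any coordinate would serve. The mix is k g at the origin and b at the all-true point, so rigidity
   forces b = k g. *)
pose t : coord := (None, set0).
have b_dep : exists s, depends_on s ((fun=> b) : cube coord -> K) by exists [::].
have := rc (cube_mix t (cube_const coord k g) b_dep).
rewrite -gc => /(_ _)/(congr1 (cube_ev (fun=> true))) E; apply: bg; apply: E.
move=> p /slice_sat_at/(_ (@origin _)) gp; apply/slice_sat_at => x.
have {}gp : sat_at i (seq1 g) p.
  by apply: (@inj_sat_at _ _ k (@gmulfM _ _ k)) => //.
have gp' := morph_sat_at (@gmulfM _ _ k) gp.
by case: (boolP (x t)) => xt; move: (bP _ gp) gp'; rewrite /slice /comp /seq1 /cube_ev /= ?xt ?(negPf xt).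
Qed.

(** A second element of the type in [G4] would make the constant value g movable, with [G4]
    extending [G2] through the constant maps. *)
Lemma rigid_singleton_ext (G4 : groupType) (j : {multiplicative G3 -> G4}) c :
  injective j -> locally_finite G4 -> rigid_elements c ->
  [set b | tp_at (j \o i13) (seq1 b) = tp_at (j \o i13) (seq1 (j c))] = [set j c].
Proof.
move=> j_inj lfG4 /rigid_not_movable[g -> nmg].
apply/seteqP; split=> [b /= bg|_ -> //]; apply: contrapT => bjg; apply: nmg.
exists G4, (j \o cube_const coord k), b; split=> //.
  by move=> x y /j_inj; exact: cube_const_inj.
move=> p gp; have : tp_at (j \o i13) (seq1 (j (cube_const coord k g))) p.
  by apply: (@morph_sat_at _ _ (j \o cube_const coord k) (@gmulfM _ _ _) _ _ _ (seq1 g)).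
by rewrite -bg.
Qed.

(** To m corresponds the map equal to [k c] where coordinate [(Some m, set0)] is true and to 1
    elsewhere; the point with only that coordinate true tells it from the others. *)
Lemma cube_power_card_ge (c : G2) : c <> 1%g -> exists f : M -> G3, injective f.
Proof.
move=> c1; have c_dep : exists s, depends_on s ((fun=> k c) : cube coord -> K) by exists [::].
exists (fun m => cube_mix ((Some m, set0) : coord) 1%g c_dep) => m m'.
pose x : cube coord := fun t => `[< t = (Some m, set0) >].
move=> /(congr1 (cube_ev x)); rewrite /cube_ev /=.
have -> : x (Some m, set0) = true by apply/asboolP.
rewrite /x; case: asboolP => [[]//|_ kc1]; case: c1; apply: k_inj.
by rewrite kc1 (morph_mul1 (@gmulfM _ _ k)) (morph_mul1 (@cube_evM _ _ _ k x)).
Qed.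

End DeltaSystems.

(** * Degenerate cases and final assembly *)

Lemma set_inj_fun (L M : Type) (m0 m1 : M) : m0 <> m1 ->
  exists f : set L -> L -> M, injective f.
Proof.
move=> m01; exists (fun S l => if `[< S l >] then m1 else m0) => S T ST.
apply/seteqP; split=> l Xl; have := congr1 (fun f => f l) ST;
  by rewrite (asboolT Xl); case: asboolP => // _ /esym; case/m01 || move/esym/m01.
Qed.

(** A nontrivial element is what lets [G3] reach the cardinality of M. A trivial group is replaced
    by the group of permutations of two points. *)
Lemma nontrivial_extension (M : Type) (G : groupType) :
  infinite_set [set: M] -> locally_finite G ->
  (exists f : G -> M, injective f) ->
  exists (H : groupType) (k : {multiplicative G -> H}),
    [/\ injective k, locally_finite H, exists f : H -> M, injective f &
        exists h : H, h <> 1%g].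
Proof.
move=> Moo lfG GM.
have [[g g1]|Gtriv] := pselect (exists g : G, g <> 1%g).
  by exists G, idfun; split=> //; exists g.
have cM : {morph (fun=> 1%g : {perm bool}) : x y / (x * y : G)%g >-> (x * y)%g}.
  by move=> x y; rewrite mulg1.
pose k : {multiplicative G -> {perm bool}} :=
  HB.pack (fun _ : G => 1%g : {perm bool}) (isMultiplicative.Build _ _ _ cM).
exists {perm bool}, k; split.
- have G1 (g : G) : g = 1%g by apply: contrapT => g1; apply: Gtriv; exists g.
  by move=> x y _; rewrite (G1 x) (G1 y).
- by move=> H _ _; exact: finite_finset.
- have [e e_inj] := infinite_nat_inj Moo; exists (e \o pickle).
  exact: inj_comp e_inj (pcan_inj pickleK).
- exists (tperm true false) => /(congr1 (fun s : {perm bool} => s true)).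
  by rewrite tpermL perm1.
Qed.

Theorem claim2p6 (L M : Type) (G1 G2 : groupType)
    (i12 : {multiplicative G1 -> G2}) :
  infinite_set [set: L] ->
  [set: M] #= [set: L -> M] ->
  locally_finite G1 -> [set: G1] #<= [set: L] ->
  locally_finite G2 -> [set: G2] #<= [set: M] ->
  injective i12 ->
  exists (G3 : groupType) (i23 : {multiplicative G2 -> G3}) (X : set G3),
    let i13 : G1 -> G3 := i23 \o i12 in
    [/\ (* (a) *)
        [/\ injective i23, locally_finite G3 & [set: G3] #= [set: M]],
        (* (b) *)
        X #<= [set: set L],
        (* (c) *)
        forall c : G3,
          let alpha :=
            X c /\
            is_singleton
              [set b : G3 | tp_at i13 (seq1 b) = tp_at i13 (seq1 c)] in
          let beta :=
            [set b : G3 | realizes_bs i13 (tp_bs i13 (seq1 c)) (seq1 b)]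
              #= [set: G3] in
          exactly_one alpha beta /\
          (alpha ->
           forall (G4 : groupType) (i34 : {multiplicative G3 -> G4}),
             injective i34 -> locally_finite G4 ->
             let i14 : G1 -> G4 := i34 \o i13 in
             is_singleton
               [set b : G4 | tp_at i14 (seq1 b) = tp_at i14 (seq1 (i34 c))])
      & (* (d); the well-ordered type (A, leA) is the ordinal alpha, and
           alpha < lambda^+ says that its cardinality is at most lambda *)
        forall (A : Type) (leA : rel A),
          wochoice.well_order leA -> [set: A] #<= [set: L] ->
          forall a : A -> G3,
          let p := tp_at i13 a in
          let p' := tp_bs i13 a in
          exists P : set (set A),
            [/\ P !=set0,
                forall u v, P u -> P v -> P (u `&` v),
                P [set: A],
                forall a' a'' : A -> G3,
                  realizes_at i13 p a' -> realizes_at i13 p a'' ->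
                  P [set b | a' b = a'' b]
              & forall u, P u ->
                  exists s : G3 -> A -> G3,
                    delta_system_along a u s /\
                    (forall e : G3, realizes_at i13 p (s e) /\
                                    realizes_bs i13 p' (s e))]].
Proof.
move=> Loo MLM lfG1 /card_leTTP G1L lfG2 /card_leTTP G2M i12_inj.
(* The equation mu = mu^lambda also allows mu = 1. Then [G2] is trivial and serves as [G3] with X
   empty: (beta) asks for one realization only, and in (d) all subsets of alpha are taken. *)
have [[m0 [m1 m01]]|Mtriv] := pselect (exists m0 m1 : M, m0 <> m1); last first.
  have [j j_inj] := G2M.
  have G2triv (x y : G2) : x = y.
    by apply: j_inj; apply: contrapT => xy; apply: Mtriv; exists (j x), (j y).
  exists G2, idfun, set0; split; first split => //.
  - rewrite card_eq_le; apply/andP; split; apply/card_leTTP => //.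
    exists (fun=> 1%g) => m m' _; apply: contrapT => mm'.
    by apply: Mtriv; exists m, m'.
  - exact: card_ge0.
  - move=> c alpha beta; split; last by case.
    right; split; first by case.
    rewrite /beta (_ : [set b | _] = [set: G2]); first exact: card_eqxx.
    apply/seteqP; split=> // b _ f cf.
    by rewrite (_ : seq1 b = seq1 c) //; apply: funext => u; exact: G2triv.
  - move=> A leA _ _ a; exists [set: set A]; split=> //; first by exists set0.
    move=> u _; exists (fun=> a); split=> [e1 e2 b1 b2|e]; last by split.
    by split=> // _; left; split; exact: G2triv.
have LM_M : exists f : (L -> M) -> M, injective f.
  by apply/card_leTTP; move: MLM; rewrite card_eq_le => /andP[].
(* From 2^lambda <= mu it follows that M is infinite and that [coord L M] injects into M. *)
have setL_M : exists f : set L -> M, injective f.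
  have [f f_inj] := LM_M; have [g g_inj] := set_inj_fun L m01.
  by exists (f \o g); exact: inj_comp.
have Moo : infinite_set [set: M].
  have [e e_inj] := infinite_nat_inj Loo; have [f f_inj] := setL_M.
  apply/infiniteP/card_leTTP; exists (fun n => f [set e n]) => n n' /f_inj E.
  by apply: e_inj; have : [set e n] (e n) by []; rewrite E.
have [G [i23 [i23_inj lfG GM [g g1]]]] := nontrivial_extension Moo lfG2 G2M.
pose i13 : {multiplicative G1 -> G} := i23 \o i12.
have [K [k [k_inj lfK KM moving]]] := exists_moving_extension i13 Moo GM lfG.
have optM : exists f : option M -> M, injective f.
  have [e e_inj] := infinite_nat_inj Moo; have [f f_inj] := infinite_pair_inj Moo.
  exists (fun o => if o is Some m then f (e 0, m) else f (e 1, e 0)).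
  move=> [m|] [m'|] // /f_inj[].
  - by move=> ->.
  - by move=> /e_inj.
  - by move=> /e_inj.
have WM : exists f : coord L M -> M, injective f by exact: card_prod_inj.
have G3M := cube_power_card k Moo WM KM.
exists (cube_power (coord L M) k), (cube_const (coord L M) k \o i23).
exists (@rigid_elements L M G1 G K i13 k); split; first split.
- by apply: inj_comp => //; exact: cube_const_inj.
- exact: cube_power_lf.
- rewrite card_eq_le; apply/andP; split; apply/card_leTTP => //.
  exact: (cube_power_card_ge _ _ k_inj g1).
- exact: rigid_card.
- move=> c alpha beta; split; last first.
    move=> [rc _] G4 j j_inj lfG4 i14; exists (j c).
    exact: (rigid_singleton_ext k_inj moving j_inj lfG4 rc).
  have [rc|nrc] := pselect (rigid_elements i13 c); last first.
    by right; split=> [[]//|]; exact: (not_rigid_card Loo G3M nrc).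
  left; split.
    split=> //; exists c; apply/seteqP; split=> [b /= bc|_ -> //].
    by apply: rc; rewrite -bc.
  (* For a rigid c, the positive formulas of its basic type already force b = c, so (beta) would
     embed the infinite M into one point. *)
  rewrite /beta card_eq_le => /andP[_ leG3]; apply: Moo.
  have /card_leTTP MG3 := cube_power_card_ge L M k_inj g1.
  apply: (card_le_finite (card_le_trans MG3 (card_le_trans leG3 _)) (finite_set1 c)).
  apply: subset_card_le => b bc; apply: rc => p cp.
  exact: (bc (Pos p)).
- move=> A leA _ /card_leTTP AL a p p'.
  (* With all agreement sets of pairs of realizations as the family, (alpha) holds at once, and each
     member comes with the pair from which its Delta-system is built. *)
  exists [set u | exists a' a'' : A -> cube_power (coord L M) k,
    [/\ realizes_at (cube_const (coord L M) k \o i13) p a',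
         realizes_at (cube_const (coord L M) k \o i13) p a'' &
         u = [set v | a' v = a'' v]]]; split.
  + by exists setT, a, a; split=> //; apply/seteqP; split.
  + move=> _ _ [a' [a'' [a'P a''P ->]]] [b' [b'' [b'P b''P ->]]].
    have [c' [c'' [c'P c''P ->]]] := agreement_setI Loo AL a'P a''P b'P b''P.
    by exists c', c''.
  + by exists a, a; split=> //; apply/seteqP; split.
  + by move=> a' a'' a'P a''P; exists a', a''.
  + move=> _ [a' [a'' [a'P a''P ->]]].
    exact: (exists_delta_system Loo AL G3M a'P a''P).
Qed.
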